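(* We have $$R(k,\ell) \le e^{-\ell/80 + o(k)} \binom{k + \ell}{\ell}$$ for every sufficiently large $k,\ell \in \mathbb{N}$ with $\ell \le 9k/10$.
   Context: The Ramsey number $R(k,\ell)$ is the minimum $n \in \mathbb{N}$ such that every red-blue colouring of the edges of the complete graph $K_n$ contains either a red copy of $K_k$ or a blue copy of $K_\ell$. The term $o(k)$ denotes a function of $k$ only (uniform over all admissible $\ell$) which, divided by $k$, tends to $0$ as $k \to \infty$. *)

(* Defs.v *)
From mathcomp Require Import all_boot.

Set Implicit Arguments.
Unset Strict Implicit.
Unset Printing Implicit Defensive.

(* The edge xy of K_n is the two-element set [set x; y]; the values of a
   colouring on sets that are not of size 2 are never inspected.
   true stands for red and false for blue. *)
Definition colouring (n : nat) := {ffun {set 'I_n} -> bool}.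

Definition mono_clique (n : nat) (c : colouring n) (b : bool)
    (A : {set 'I_n}) : bool :=
  [forall x in A, forall y in A, (x != y) ==> (c [set x; y] == b)].

Definition has_copy (n : nat) (c : colouring n) (b : bool) (k : nat) : bool :=
  [exists A : {set 'I_n}, (#|A| == k) && mono_clique c b A].

Definition ramsey_prop (k l n : nat) : bool :=
  [forall c : colouring n, has_copy c true k || has_copy c false l].

Lemma mono_cliqueU1 (n : nat) (c : colouring n) (b : bool) (x : 'I_n)
    (A : {set 'I_n}) :
  {in A, forall y, c [set x; y] = b} -> mono_clique c b A ->
  mono_clique c b (x |: A).
Proof.
move=> hx /forall_inP hA; apply/forall_inP => y /setU1P [->|yA];
  apply/forall_inP => z /setU1P [->|zA]; apply/implyP => yz.
- by rewrite eqxx in yz.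
- by rewrite hx.
- by rewrite setUC hx.
- by move/forall_inP: (hA _ yA) => /(_ _ zA) /implyP; apply.
Qed.

Lemma ramsey_in (n : nat) (c : colouring n) (k l : nat) (S : {set 'I_n}) :
  'C(k + l, k) <= #|S| ->
  (exists A : {set 'I_n}, [/\ A \subset S, #|A| = k & mono_clique c true A]) \/
  (exists A : {set 'I_n}, [/\ A \subset S, #|A| = l & mono_clique c false A]).
Proof.
have mono0 b : mono_clique c b set0.
  by apply/forall_inP => x; rewrite inE.
elim: k l S => [|k IHk] l S.
  by left; exists set0; rewrite sub0set cards0.
elim: l S => [|l IHl] S.
  by right; exists set0; rewrite sub0set cards0.
move=> hS; have /card_gt0P [x xS] : 0 < #|S|.
  by apply: leq_trans hS; rewrite bin_gt0 leq_addr.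
pose N b := [set y in S :\ x | c [set x; y] == b].
have NS b : N b \subset S :\ x by apply/subsetP => y; rewrite inE => /andP [].
have NSS b : N b \subset S by apply: subset_trans (NS b) (subD1set _ _).
have cN : #|N true| + #|N false| = #|S :\ x|.
  rewrite -(cardsID [set y | c [set x; y]] (S :\ x)).
  by congr (_ + _); apply: eq_card => y; rewrite !inE;
    case: (c _) => /=; rewrite ?andbT ?andbF.
have ext b m (A : {set 'I_n}) : A \subset N b -> #|A| = m ->
    mono_clique c b A ->
    [/\ x |: A \subset S, #|x |: A| = m.+1 & mono_clique c b (x |: A)].
  move=> AN cA mA; split.
  - by rewrite subUset sub1set xS (subset_trans AN).
  - rewrite cardsU1 cA.
    case: (boolP (x \in A)) => // xA.
    by have := subsetP AN _ xA; rewrite !inE eqxx.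
  - apply: mono_cliqueU1 => // y yA.
    by have := subsetP AN _ yA; rewrite inE => /andP [_ /eqP].
have : ('C(k + l.+1, k) <= #|N true|) || ('C(k.+1 + l, k.+1) <= #|N false|).
  apply: contraLR hS; rewrite negb_or -!ltnNge => /andP [h1 h2].
  rewrite (cardsD1 x S) xS -cN -addnS [k.+1 + _]addSn binS [X in _ < X]addnC.
  rewrite addSnnS in h2; apply: leq_trans (leq_add h1 h2).
  by rewrite addSn addnS; apply: leqnn.
case/orP => [/IHk|/IHl] [] [A [AN cA mA]].
- by left; exists (x |: A); apply: ext.
- by right; exists A; split=> //; apply: subset_trans AN (NSS _).
- by left; exists A; split=> //; apply: subset_trans AN (NSS _).
- by right; exists (x |: A); apply: ext.
Qed.

Lemma ramsey_ex (k l : nat) : exists n, ramsey_prop k l n.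
Proof.
exists 'C(k + l, k); apply/forallP => c; apply/orP.
have [|[A [_ cA mA]]|[A [_ cA mA]]] := @ramsey_in _ c k l setT.
- by rewrite cardsT card_ord.
- by left; apply/existsP; exists A; rewrite cA eqxx.
- by right; apply/existsP; exists A; rewrite cA eqxx.
Qed.

Definition ramsey (k l : nat) : nat := ex_minn (ramsey_ex k l).

(* Main.v *)
Require Import Defs.
From mathcomp Require Import all_boot all_order all_algebra.
From mathcomp Require Import ring lra.
Import Order.TTheory GRing.Theory Num.Theory.
Local Open Scope ring_scope.

(** Write t = l / k and let U(k, l) be k^5 exp(-(l/20 - l^2/(24k))) C(k+l, l),
    which for t <= 9/10 is at most k^5 exp(-l/80) C(k+l, l); the factor k^5 is
    e^o(k).  By induction on l, every set S of at least U(k, l) vertices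
    contains a red K_k or a blue K_l ([clique_of_ramsey_bound]).

    Suppose S contains neither.  The blue neighbourhood in S of a vertex
    contains no red K_k and no blue K_(l-1), so by induction it has fewer than
    U(k, l-1) vertices.  Hence the red density inside S is at least
    1 - U(k, l-1) / U(k, l), which exceeds p = D(t) / (1 + t), where
    D(t) = 1 - 3t/50 + t^2/12.  The rest shows that so dense a red graph
    without the two cliques is too small.

    The engine is [excess_le].  The excess of a pair X, Y is
    e_red(X, Y) - p |X| |Y|.  For v in X, replace Y by the red neighbourhood Y_v
    of v in Y, and X by the red or the blue neighbourhood of v in X.  Up to a
    term for v itself, the two new excesses add up to the excess of (X, Y_v),
    which by Cauchy-Schwarz is on average at least p times the old excess:
    density correlates with itself.  So one of the two pairs keeps its share of the excess.  A red
    choice puts v in a red clique joined in red to everything that remains; a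
    blue choice puts v in a blue clique joined in blue to what remains of X.
    There are at most k red and l blue choices, while Y, which contains no blue
    K_l, stays below the Erdos-Szekeres bound C(k'+l, l), k' being the number
    of red choices left.  Measuring the excess relative to |Y|^(3/4) rather
    than to |X| |Y| makes the loss per step p^(1/4); giving Y this small a
    weight is what leaves room up to t = 9/10.

    Splitting the share p^(1/4) between red and blue in the ratio 1 : t gives,
    up to polynomial factors,
      |S|^5 <= B^5 / (D(t)^(k+l) (q/t)^l),   B = (1+t)^(k+l) / t^l,
    with q = 1 - D(t) / (1+t)^5, and B is C(k+l, l) up to a factor k+l+1.
    So it remains to check D(t)^(k+l) (q/t)^l >= exp(5 (l/20 - l^2/(24k)))
    ([gain_pow_ge]): the gain comes from q being larger than t.  This gain is scarcest near t = 9/10, which is why the exponent of U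
    is quadratic in l: past t = 3/5 the saving l/20 - l^2/(24k) decreases with l
    (its derivative 1/20 - t/12 is negative), so the induction allows fewer blue
    neighbours and the red density near t = 9/10 exceeds even the
    Erdos-Szekeres value 1 / (1+t). *)

(** * Cliques and neighbourhoods in a coloured complete graph *)

Definition nbr {n : nat} (c : colouring n) (b : bool) (v : 'I_n) : {set 'I_n} :=
  [set y | (y != v) && (c [set v; y] == b)].

Definition clique_in {n : nat} (c : colouring n) (b : bool) (k : nat)
    (S : {set 'I_n}) : bool :=
  [exists A : {set 'I_n}, [&& A \subset S, #|A| == k & mono_clique c b A]].

Lemma nbr_sym (n : nat) (c : colouring n) (b : bool) (u v : 'I_n) :
  (u \in nbr c b v) = (v \in nbr c b u).
Proof. by rewrite !inE eq_sym setUC. Qed.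

Lemma clique_in_subset (n : nat) (c : colouring n) (b : bool) (k : nat)
    (S T : {set 'I_n}) :
  S \subset T -> clique_in c b k S -> clique_in c b k T.
Proof.
move=> ST /existsP [A /and3P [AS cA mA]]; apply/existsP; exists A.
by rewrite (subset_trans AS ST) cA.
Qed.

Lemma clique_in0 (n : nat) (c : colouring n) (b : bool) (S : {set 'I_n}) :
  clique_in c b 0 S.
Proof.
apply/existsP; exists finset.set0; rewrite sub0set cards0 eqxx.
by apply/forall_inP => x; rewrite inE.
Qed.

(** One step of any greedy search: the chosen vertex [v] extends every clique
    found inside its neighbourhood of the same colour. *)
Lemma clique_in_nbr (n : nat) (c : colouring n) (b : bool) (k : nat)
    (v : 'I_n) (S : {set 'I_n}) :
  v \in S -> clique_in c b k (S :&: nbr c b v) -> clique_in c b k.+1 S.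
Proof.
move=> vS /existsP [A /and3P [AS /eqP cA mA]]; apply/existsP; exists (v |: A).
have vA : v \notin A.
  by apply: contraTN isT => vA; move: (subsetP AS _ vA); rewrite !inE eqxx andbF.
rewrite subUset sub1set vS (subset_trans AS (subsetIl _ _)) cardsU1 vA cA eqxx.
apply: mono_cliqueU1 => // y yA.
by have := subsetP AS _ yA; rewrite !inE => /and3P [_ _ /eqP].
Qed.

Lemma card_lt_bin (n : nat) (c : colouring n) (k l : nat) (S : {set 'I_n}) :
  ~~ clique_in c true k S -> ~~ clique_in c false l S ->
  (#|S| < 'C(k + l, k))%N.
Proof.
move=> nR nB; rewrite ltnNge; apply/negP => /(@ramsey_in _ c).
case=> [] [A [AS cA mA]].
  by case/existsP: nR; exists A; rewrite AS cA eqxx.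
by case/existsP: nB; exists A; rewrite AS cA eqxx.
Qed.

Lemma card_nbr_split (n : nat) (c : colouring n) (v : 'I_n) (X : {set 'I_n}) :
  v \in X ->
  #|X| = (#|X :&: nbr c true v| + #|X :&: nbr c false v|).+1.
Proof.
move=> vX; rewrite (cardsD1 v) vX add1n; congr _.+1.
rewrite -(cardsID (nbr c true v) (X :\ v)); congr (_ + _)%N; apply: eq_card => y;
  rewrite !inE; case: (eqVneq y v) => _; rewrite ?andbF ?andbT //=.
by rewrite andbC; case: (c _).
Qed.

(** * The excess of red edges between two sets *)

Section Excess.
Variables (R : rcfType) (n : nat) (c : colouring n).
Implicit Types (X Y : {set 'I_n}) (v y : 'I_n).

Local Notation red := (nbr c true).
Local Notation blue := (nbr c false).

(** [excess p X Y] is e_red(X, Y) - p |X| |Y|, written as a sum over [Y] so that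
    restricting [Y] restricts the sum.  The sets [X] and [Y] may overlap. *)
Definition excess (p : R) (X Y : {set 'I_n}) : R :=
  \sum_(y in Y) (#|X :&: red y|%:R - p * #|X|%:R).

Definition root4 (x : R) : R := Num.sqrt (Num.sqrt x).

Lemma root4_ge0 x : 0 <= root4 x. Proof. exact: sqrtr_ge0. Qed.

Lemma root4K x : 0 <= x -> root4 x ^+ 4 = x.
Proof.
move=> x0; rewrite (_ : 4 = 2 * 2)%N // exprM !sqr_sqrtr //; exact: sqrtr_ge0.
Qed.

(** Every vertex of [X] other than [v] lies in exactly one of the two
    neighbourhoods of [v]; the last term is the contribution of [v] itself,
    which is red to all of [Y]. *)
Lemma excess_split p X Y v : v \in X -> Y \subset red v ->
  excess p X Y =
  excess p (X :&: red v) Y + excess p (X :&: blue v) Y + (1 - p) * #|Y|%:R.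
Proof.
move=> vX /subsetP YN; rewrite /excess -big_split /=.
rewrite [(1 - p) * _]mulr_natr -[(1 - p) *+ _]sumr_const -big_split /=.
apply: eq_bigr => y /YN yv.
rewrite (card_nbr_split n c v X vX).
have -> : #|X :&: red y| =
    (#|X :&: red v :&: red y| + #|X :&: blue v :&: red y|).+1.
  rewrite (card_nbr_split n c v (X :&: red y)); last first.
    by rewrite inE vX nbr_sym.
  by rewrite setIAC [in X in (_ + X)%N]setIAC.
rewrite -!natr1 !natrD; ring.
Qed.

Lemma sum_nbr_exchange (X Y : {set 'I_n}) (f : 'I_n -> R) :
  \sum_(v in X) \sum_(y in Y :&: red v) f y =
  \sum_(y in Y) #|X :&: red y|%:R * f y.
Proof.
transitivity (\sum_(v in X) \sum_(y in Y | y \in red v) f y).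
  by apply: eq_bigr => v _; apply: eq_bigl => y; rewrite inE.
rewrite (exchange_big_dep (mem Y)) /=; last by move=> v y _ /andP [].
apply: eq_bigr => y yY; rewrite mulr_natl -sumr_const.
by apply: eq_bigl => v; rewrite !inE yY /= eq_sym setUC.
Qed.

Lemma sqr_sum_le (X : {set 'I_n}) (f : 'I_n -> R) :
  (\sum_(y in X) f y) ^+ 2 <= #|X|%:R * \sum_(y in X) f y ^+ 2.
Proof.
have [->|X0] := eqVneq X finset.set0.
  by rewrite !big_set0 cards0 mul0r expr0n.
have m0 : 0 < #|X|%:R :> R by rewrite ltr0n card_gt0.
set E := \sum_(y in X) f y.
have : 0 <= \sum_(y in X) (#|X|%:R * f y - E) ^+ 2.
  by apply: sumr_ge0 => y _; apply: sqr_ge0.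
have -> : \sum_(y in X) (#|X|%:R * f y - E) ^+ 2 =
   #|X|%:R * (#|X|%:R * (\sum_(y in X) f y ^+ 2) - E ^+ 2).
  transitivity (\sum_(y in X) (#|X|%:R ^+ 2 * f y ^+ 2
                  - 2 * #|X|%:R * E * f y + E ^+ 2)).
    by apply: eq_bigr => y _; ring.
  rewrite !big_split /= sumrN -!mulr_sumr sumr_const -/E -mulr_natl; ring.
by rewrite pmulr_rge0 // subr_ge0.
Qed.

(** Jensen's inequality for the concave function x^(3/4), where t^4 is the mean
    of [f] over [X]; it is proved through the tangent at that mean. *)
Lemma sum_cube_root4_le (X : {set 'I_n}) (f : 'I_n -> R) (t : R) :
  0 < t -> (forall x, x \in X -> 0 <= f x) ->
  \sum_(x in X) f x = #|X|%:R * t ^+ 4 ->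
  \sum_(x in X) root4 (f x) ^+ 3 <= #|X|%:R * t ^+ 3.
Proof.
move=> t0 f0 fE.
have h x : x \in X -> root4 (f x) ^+ 3 <= 3 / 4 / t * f x + t ^+ 3 / 4.
  move=> xX; rewrite -{2}(root4K (f x)) ?f0 //.
  have := root4_ge0 (f x); set z := root4 _ => z0.
  rewrite -(ler_pM2r (_ : 0 < 4 * t)); last by lra.
  have -> : (3 / 4 / t * z ^+ 4 + t ^+ 3 / 4) * (4 * t) = 3 * z ^+ 4 + t ^+ 4.
    by field; lra.
  (* 3 z^4 - 4 z^3 t + t^4 vanishes doubly at z = t *)
  have -> : 3 * z ^+ 4 + t ^+ 4 = z ^+ 3 * (4 * t)
    + (z - t) ^+ 2 * (2 * z ^+ 2 + (z + t) ^+ 2) by ring.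
  rewrite lerDl mulr_ge0 ?sqr_ge0 // addr_ge0 ?sqr_ge0 // mulr_ge0 ?sqr_ge0 //.
apply: (le_trans (ler_sum _ h)).
rewrite big_split /= -mulr_sumr fE sumr_const -mulr_natl le_eqVlt; apply/orP; left.
by apply/eqP; field; lra.
Qed.

(** Here [P] is p^(1/4), [k] and [m] are the numbers of red and blue choices
    left, and [a^-1], [b^-1] are the shares of the excess per |Y|^(3/4) that a
    red and a blue choice are asked to keep.  The induction goes through because
    averaging over [v] leaves a factor p^(1/4) in total, at least the sum of the
    two shares.  The vertex [v] itself costs at most |Y|, that is |Y|^(1/4) times
    |Y|^(3/4); as [Y] is bounded by a binomial coefficient, [M * a ^+ k]
    dominates that cost, which is then paid once per step: this is the factor
    [k + m]. *)
Lemma excess_le (P M a b : R) (l : nat) :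
  0 < P -> P <= 1 -> 0 <= M -> 0 < a -> 1 <= b ->
  a^-1 + b^-1 <= P ->
  (forall k, ('C(k + l, k))%:R <= (M * a ^+ k) ^+ 4) ->
  forall (k m : nat) (X Y : {set 'I_n}),
  ~~ clique_in c true k (X :|: Y) -> ~~ clique_in c false m X ->
  ~~ clique_in c false l Y ->
  excess (P ^+ 4) X Y <=
    (k + m)%:R * (M * a ^+ k * b ^+ m) * root4 #|Y|%:R ^+ 3.
Proof.
move=> P0 P1 M0 a0 b1 hab hM k m.
have b0 : 0 < b by lra.
set p := P ^+ 4.
have p0 : 0 < p by rewrite exprn_gt0.
move: {2}(k + m)%N (leqnn (k + m)) => N.
elim: N k m => [|N IH] [|k] [|m] // hN X Y nR nB nY;
  try by rewrite clique_in0 in nR.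
  by rewrite clique_in0 in nB.
have [F0|F0] := leP (excess p X Y) 0.
  apply: (le_trans F0); rewrite !mulr_ge0 ?exprn_ge0 ?root4_ge0 //; exact: ltW.
pose Yv v := Y :&: red v.
pose d y : R := #|X :&: red y|%:R.
pose E : R := \sum_(y in Y) d y.
pose nX : R := #|X|%:R.
pose mY : R := #|Y|%:R.
pose G : R := M * a ^+ k.+1 * b ^+ m.+1.
pose S : R := (k + m).+1%:R * G * P.
have G0 : 0 <= G by rewrite !mulr_ge0 ?exprn_ge0 //; exact: ltW.
have S0 : 0 <= S by apply: mulr_ge0 (ltW P0); apply: mulr_ge0.
have FE : excess p X Y = E - p * nX * mY.
  rewrite /excess big_split /= sumrN sumr_const -[(_ * _) *+ _]mulr_natl.
  by rewrite -/E -/mY -/nX; ring.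
have mY0 : 0 < mY.
  rewrite ltr0n card_gt0; apply: contraTneq F0 => ->.
  by rewrite /excess big_set0 ltxx.
have nX0 : 0 < nX.
  rewrite ltr0n card_gt0; apply: contraTneq F0 => X0.
  rewrite /excess X0 big1 ?ltxx // => y _.
  by rewrite finset.set0I cards0 mulr0 subrr.
have E0 : p * nX * mY < E by rewrite -subr_gt0 -FE.
(* the induction hypothesis for a red choice and for a blue choice of v *)
have step v : v \in X ->
    excess p X (Yv v) <= S * root4 #|Yv v|%:R ^+ 3 + #|Yv v|%:R.
  move=> vX; rewrite (excess_split p X (Yv v) v vX (subsetIr _ _)).
  have h1 : excess p (X :&: red v) (Yv v) <=
     (k + m.+1)%:R * (M * a ^+ k * b ^+ m.+1) * root4 #|Yv v|%:R ^+ 3.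
    apply: IH.
    - by move: hN; rewrite addSn ltnS.
    - rewrite /Yv -setIUl; apply: contra nR => h; apply: clique_in_nbr h.
      by rewrite inE vX.
    - apply: contra nB; apply: clique_in_subset; exact: subsetIl.
    - apply: contra nY; apply: clique_in_subset; exact: subsetIl.
  have h2 : excess p (X :&: blue v) (Yv v) <=
     (k.+1 + m)%:R * (M * a ^+ k.+1 * b ^+ m) * root4 #|Yv v|%:R ^+ 3.
    apply: IH.
    - by move: hN; rewrite addnS ltnS.
    - apply: contra nR; apply: clique_in_subset.
      by apply: setUSS; apply: subsetIl.
    - by apply: contra nB; apply: clique_in_nbr.
    - apply: contra nY; apply: clique_in_subset; exact: subsetIl.
  have h3 : (1 - p) * #|Yv v|%:R <= #|Yv v|%:R :> R.
    by rewrite ler_piMl //; lra.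
  apply: (le_trans (lerD (lerD h1 h2) h3)); rewrite lerD2r.
  rewrite -mulrDl ler_wpM2r ?exprn_ge0 ?root4_ge0 //.
  rewrite addnS addSn -mulrDr.
  have -> : M * a ^+ k * b ^+ m.+1 + M * a ^+ k.+1 * b ^+ m = G * (a^-1 + b^-1).
    by rewrite /G !exprS; field; lra.
  rewrite /S -[_ * G * P]mulrA; apply: ler_wpM2l => //.
  exact: ler_wpM2l.
pose t := root4 (E / nX).
have Epos : 0 < E by apply: le_lt_trans E0; rewrite !mulr_ge0 // ltW.
have t4 : t ^+ 4 = E / nX by rewrite root4K // divr_ge0 ?ltW.
have t0 : 0 < t.
  rewrite lt_neqAle root4_ge0 andbT eq_sym; apply: contraTneq Epos => tt.
  move: t4; rewrite tt expr0n /= => /esym /eqP.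
  by rewrite mulf_eq0 invr_eq0 (gt_eqF nX0) orbF => /eqP ->; rewrite ltxx.
have sumY : \sum_(v in X) #|Yv v|%:R = E.
  transitivity (\sum_(v in X) \sum_(y in Yv v) (1 : R)).
    by apply: eq_bigr => v _; rewrite sumr_const.
  by rewrite sum_nbr_exchange; apply: eq_bigr => y _; rewrite mulr1.
have up : \sum_(v in X) excess p X (Yv v) <= S * (nX * t ^+ 3) + E.
  apply: (le_trans (ler_sum _ step)); rewrite big_split /= sumY lerD2r -mulr_sumr.
  rewrite ler_wpM2l //; apply: sum_cube_root4_le => //.
  by rewrite sumY t4 -/nX; field; lra.
(* Cauchy-Schwarz: the red degrees into X, weighted by themselves *)
have low : E * excess p X Y <= mY * \sum_(v in X) excess p X (Yv v).
  rewrite sum_nbr_exchange.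
  have -> : \sum_(y in Y) #|X :&: red y|%:R * (#|X :&: red y|%:R - p * #|X|%:R)
     = (\sum_(y in Y) d y ^+ 2) - p * nX * E.
    rewrite /E mulr_sumr -sumrB; apply: eq_bigr => y _; rewrite /d /nX; ring.
  have := sqr_sum_le Y d; rewrite -/E -/mY => h.
  rewrite FE [X in _ <= X]mulrBr; apply: le_trans (lerB h (lexx _)).
  by rewrite le_eqVlt; apply/orP; left; apply/eqP; ring.
pose z := root4 mY.
have z4 : z ^+ 4 = mY by rewrite root4K // ltW.
have z0 : 0 <= z by apply: root4_ge0.
have Ent : E = nX * t ^+ 4 by rewrite t4; field; lra.
(* positive excess: the mean of |Yv v| is at least p |Y| *)
have zt : P * z <= t.
  rewrite -(@ler_pXn2r _ 4) ?nnegrE ?(mulr_ge0 (ltW P0)) ?(ltW t0) //.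
  by rewrite exprMn z4 t4 ler_pdivlMr // -/p mulrAC ltW.
have F1 : t * excess p X Y <= mY * (S + t).
  rewrite -(ler_pM2l (_ : 0 < nX * t ^+ 3)); last by rewrite mulr_gt0 ?exprn_gt0.
  apply: le_trans (_ : E * excess p X Y <= _).
    by rewrite Ent le_eqVlt; apply/orP; left; apply/eqP; ring.
  apply: (le_trans low); apply: le_trans (_ : mY * (S * (nX * t ^+ 3) + E) <= _).
    by rewrite ler_wpM2l // ltW.
  by rewrite Ent le_eqVlt; apply/orP; left; apply/eqP; ring.
have F2 : P * excess p X Y <= z ^+ 3 * S + P * mY.
  have zpos : 0 < z.
    rewrite lt_neqAle z0 andbT; apply: contraTneq mY0 => zz.
    by rewrite -z4 -zz expr0n ltxx.
  have : excess p X Y - mY <= mY * S / t.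
    by rewrite ler_pdivlMr // mulrBl; lra.
  move=> h.
  have h' : mY * S / t <= mY * S / (P * z).
    apply: ler_wpM2l; first exact: mulr_ge0 (ltW mY0) S0.
    by rewrite lef_pV2 ?posrE // mulr_gt0.
  have e : mY * S / (P * z) = z ^+ 3 * S / P by rewrite -z4; field; lra.
  have := le_trans h h'; rewrite e ler_pdivlMr //; lra.
(* absorbing the cost of the chosen vertices *)
have z1 : z <= M * a ^+ k.+1.
  rewrite -(@ler_pXn2r _ 4) ?nnegrE ?(mulr_ge0 M0) ?exprn_ge0 ?(ltW a0) // z4.
  apply: le_trans (hM k.+1); rewrite ler_nat ltnW //.
  apply: (card_lt_bin n c) => //; apply: contra nR; apply: clique_in_subset.
  exact: subsetUr.
have z2 : mY <= z ^+ 3 * G.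
  rewrite -z4 exprSr ler_wpM2l ?exprn_ge0 //; apply: (le_trans z1).
  rewrite /G ler_peMr // ?(mulr_ge0 M0) ?exprn_ge0 ?(ltW a0) //.
  by apply: exprn_ege1.
rewrite -(ler_pM2l P0); apply: (le_trans F2).
rewrite -/mY -/z -/G addSn addnS -[(_.+2)%:R]natr1.
have -> : P * (((k + m).+1%:R + 1) * G * z ^+ 3) = z ^+ 3 * S + P * (z ^+ 3 * G).
  by rewrite /S; ring.
by rewrite lerD2l ler_wpM2l // ltW.
Qed.

End Excess.

Arguments excess {R n} c p X Y.
Arguments root4 {R} x.

(** * Binomial coefficients and powers *)

(** A single term of the binomial expansion of (q + (1 - q))^(k+l) = 1. *)
Lemma bin_mul_exp_le1 (R : realFieldType) (q : R) (k l : nat) :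
  0 <= q -> q <= 1 -> ('C(k + l, k))%:R * ((1 - q) ^+ k * q ^+ l) <= 1.
Proof.
move=> q0 q1; have q1' : 0 <= 1 - q by lra.
have e : (q + (1 - q)) ^+ (k + l) = 1 by rewrite addrC subrK expr1n.
rewrite -[leRHS]e [leRHS]exprDn (bigD1 (inord k)) //=.
rewrite inordK ?ltnS ?leq_addr // addKn.
rewrite mulr_natl [(1 - q) ^+ k * _]mulrC lerDl sumr_ge0 // => i _.
by rewrite mulrn_wge0 // mulr_ge0 // exprn_ge0.
Qed.

(** The terms C(k+l, i) k^(k+l-i) l^i are unimodal in [i] with mode [l]: the ratio
    of consecutive terms is (k + l - i) l / ((i + 1) k). *)
Lemma bin_term_le (k l i : nat) : (0 < k)%N -> (0 < l)%N -> (i <= k + l)%N ->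
  ('C(k + l, i) * (k ^ (k + l - i) * l ^ i) <= 'C(k + l, l) * (k ^ k * l ^ l))%N.
Proof.
move=> k0 l0; set N := (k + l)%N.
pose t j := ('C(N, j) * (k ^ (N - j) * l ^ j))%N.
rewrite -/(t i) => iN.
have -> : ('C(N, l) * (k ^ k * l ^ l))%N = t l by rewrite /t /N addnK.
have rat j : (j < N)%N -> (t j.+1 * (j.+1 * k) = t j * ((N - j) * l))%N.
  move=> jN; rewrite /t.
  have -> : (N - j = (N - j.+1).+1)%N by rewrite subnSK.
  rewrite !expnS; have := mul_bin_left N j.
  rewrite -[in X in _ = (X * _)%N](subnSK jN).
  set x := 'C(N, j.+1); set y := 'C(N, j) => e.
  transitivity ((j.+1 * x) * (k ^ (N - j.+1) * (l * l ^ j) * k))%N; first by ring.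
  by rewrite e; ring.
have up j : (j < l)%N -> (t j <= t j.+1)%N.
  move=> jl; have jN : (j < N)%N by rewrite (leq_trans jl) // leq_addl.
  rewrite -(@leq_pmul2r (j.+1 * k)) ?muln_gt0 //= rat // leq_mul2l.
  apply/orP; right; rewrite [leqRHS]mulnC leq_mul //.
  by rewrite leq_subRL ?(ltnW jN) // /N; rewrite addnC leq_add2l ltnW.
have down j : (l <= j < N)%N -> (t j.+1 <= t j)%N.
  move=> /andP [lj jN].
  rewrite -(@leq_pmul2r (j.+1 * k)) ?muln_gt0 //= rat // leq_mul2l.
  apply/orP; right; rewrite mulnC leq_mul //; first by rewrite ltnW.
  by rewrite leq_subLR /N addnC leq_add2r.
have [il|li] := leqP i l.
  rewrite -(subKn il); elim: (l - i)%N (leq_subr i l) => [|d IH] dl.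
    by rewrite subn0.
  apply: leq_trans (IH (ltnW dl)); rewrite -(subnSK dl); apply: up.
  by rewrite ltn_subrL l0.
rewrite -(subnKC (ltnW li)) in iN *; elim: (i - l)%N iN => [|d IH] dN.
  by rewrite addn0.
rewrite addnS in dN *; apply: leq_trans (IH (ltnW dN)); apply: down.
by rewrite leq_addr.
Qed.

(** The binomial expansion of (k+l)^(k+l) has k+l+1 terms, the largest of
    which is the one bounded here. *)
Lemma expn_le_bin (k l : nat) : (0 < k)%N -> (0 < l)%N ->
  ((k + l) ^ (k + l) <= (k + l).+1 * ('C(k + l, l) * (k ^ k * l ^ l)))%N.
Proof.
move=> k0 l0; rewrite [X in (X <= _)%N]Pascal.
rewrite -[X in (_ <= X * _)%N]card_ord -sum_nat_const.
by apply: leq_sum => i _; apply: bin_term_le; rewrite // -ltnS.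
Qed.

(** * The numerical inequality behind the constant 1/80 *)

From mathcomp Require Import all_classical all_reals all_analysis.
Import numFieldNormedType.Exports.
Local Open Scope ring_scope.

Section Bound.
Variable R : realType.

Lemma expR_le_inv (x : R) : x < 1 -> expR x <= (1 - x)^-1.
Proof.
move=> x1; rewrite -[x in expR x]opprK expRN.
rewrite lef_pV2 ?posrE ?expR_gt0 ?subr_gt0 //.
exact: expR_ge1Dx.
Qed.

(** The form ln y >= 1 - 1/y of the tangent bound for the logarithm. *)
Lemma expR_le (y : R) : 0 < y -> expR (1 - y^-1) <= y.
Proof.
move=> y0; rewrite -[leRHS]invrK -[1 - _]opprB.
rewrite expRN lef_pV2 ?posrE ?expR_gt0 ?invr_gt0 //.
by apply: le_trans (expR_ge1Dx _); rewrite addrC subrK.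
Qed.

(** The slack 1/200 between this bound and the tangent x + 1 becomes the gap
    between the red density and D(t) / (1+t); the interval is the range of
    1/20 - t/12 for t in [0, 9/10]. *)
Lemma expR_le_affine (x h : R) : - (1 / 40) <= x -> x <= 1 / 20 ->
  0 <= h -> h <= 1 / 1000 -> expR (x + h) <= x + 201 / 200.
Proof.
move=> x0 x1 h0 h1; apply: le_trans (expR_le_inv _ _) _; first by lra.
rewrite invf_ple ?posrE; [|lra|lra].
rewrite -div1r ler_pdivrMr; [nra|lra].
Qed.

(** The function D(t): the red density in play is D(t) / (1+t), to be compared
    with 1 / (1+t), the red share in the Erdos-Szekeres recursion. *)
Definition dens_factor (t : R) : R := 1 - 3 / 50 * t + t ^+ 2 / 12.
(** The parameter q at which C(k'+l, l) <= q^(-l) (1-q)^(-k') is used.  It is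
    chosen so that (1-q)^(-1/4) is the factor lost per red choice, which makes
    the bound on |Y| equally strong at every stage k'. *)
Definition tail_prob (t : R) : R := 1 - dens_factor t / (1 + t) ^+ 5.

Lemma dens_factor_bounds t : 0 <= t -> t <= 9 / 10 ->
  98 / 100 <= dens_factor t /\ dens_factor t <= 1 + 3 / 200 * t.
Proof.
by move=> t0 t1; rewrite /dens_factor; split; [have := sqr_ge0 (t - 9 / 25)|]; nra.
Qed.

(** The quadratic is just below the largest value of t / q that
    [gain_slope_ge] tolerates.  After clearing denominators and dividing by [t],
    two polynomials are compared; higher powers of [t] are bounded by multiples
    of [t]. *)
Lemma tail_prob_ge t : 0 < t -> t <= 9 / 10 ->
  t <= tail_prob t * (689 / 1000 + 231 / 1000 * t + 83 / 1000 * t ^+ 2).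
Proof.
move=> t0 t1; have [_ dub] := dens_factor_bounds t (ltW t0) t1.
set G := (X in _ * X).
have G0 : 0 <= G by rewrite /G; nra.
have u0 : 0 < (1 + t) ^+ 5 by rewrite exprn_gt0 //; lra.
rewrite -(ler_pM2r u0) mulrAC.
have -> : tail_prob t * (1 + t) ^+ 5 = (1 + t) ^+ 5 - dens_factor t.
  by rewrite /tail_prob mulrBl mul1r divfK // gt_eqF.
pose A : R := 997 / 200 + 10 * t + 10 * t ^+ 2 + 5 * t ^+ 3 + t ^+ 4.
have h1 : t * A <= (1 + t) ^+ 5 - dens_factor t.
  have -> : t * A = (1 + t) ^+ 5 - (1 + 3 / 200 * t) by rewrite /A; field.
  lra.
have h2 : (1 + t) ^+ 5 <= A * G.
  have t2 : t ^+ 2 <= 9 / 10 * t by rewrite expr2 ler_wpM2r // ltW.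
  have t2' : 0 <= t ^+ 2 by rewrite sqr_ge0.
  have t3 : t ^+ 3 <= 81 / 100 * t by rewrite exprS; nra.
  have t3' : 0 <= t ^+ 3 by rewrite exprn_ge0 // ltW.
  have t4 : t ^+ 4 <= 729 / 1000 * t by rewrite exprS; nra.
  have t4' : 0 <= t ^+ 4 by rewrite exprn_ge0 // ltW.
  have t5 : t ^+ 5 <= 6561 / 10000 * t by rewrite exprS; nra.
  have t5' : 0 <= t ^+ 5 by rewrite exprn_ge0 // ltW.
  have t6' : 0 <= t ^+ 6 by rewrite exprn_ge0 // ltW.
  rewrite -subr_ge0.
  set F := (X in 0 <= X).
  have -> : F = (997 / 200 * (689 / 1000) - 1)
     + (10 * (689 / 1000) + 997 / 200 * (231 / 1000) - 5) * t
     + (10 * (689 / 1000) + 10 * (231 / 1000) + 997 / 200 * (83 / 1000) - 10) * t ^+ 2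
     + (5 * (689 / 1000) + 10 * (231 / 1000) + 10 * (83 / 1000) - 10) * t ^+ 3
     + (689 / 1000 + 5 * (231 / 1000) + 10 * (83 / 1000) - 5) * t ^+ 4
     + (231 / 1000 + 5 * (83 / 1000) - 1) * t ^+ 5
     + 83 / 1000 * t ^+ 6 by rewrite /F /A /G; field.
  lra.
apply: le_trans (_ : t * (A * G) <= _); first by rewrite ler_wpM2l // ltW.
by rewrite mulrA ler_wpM2r.
Qed.

Lemma tail_prob_gt0 t : 0 < t -> t <= 9 / 10 -> 0 < tail_prob t.
Proof.
move=> t0 t1; have := tail_prob_ge t t0 t1; set G := (X in _ * X) => h.
have G0 : 0 < G by rewrite /G; nra.
by rewrite -(pmulr_lgt0 _ G0); apply: lt_le_trans h.
Qed.

(** The logarithm of [gain_pow_ge] divided by [l], with ln y replaced by its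
    lower bound 1 - 1/y. *)
Lemma gain_slope_ge t : 0 < t -> t <= 9 / 10 ->
  5 * (1 / 20 - t / 24) <=
   (1 + t) / t * (1 - (dens_factor t)^-1) + (1 - t / tail_prob t).
Proof.
move=> t0 t1; have [dlb _] := dens_factor_bounds t (ltW t0) t1.
have d0 : 0 < dens_factor t by lra.
have q0 := tail_prob_gt0 t t0 t1.
have h1 : t / tail_prob t <= 689 / 1000 + 231 / 1000 * t + 83 / 1000 * t ^+ 2.
  by rewrite ler_pdivrMr // mulrC tail_prob_ge.
pose w := t / 12 - 3 / 50.
have dw : dens_factor t = 1 + t * w by rewrite /dens_factor /w; field.
have -> : (1 + t) / t * (1 - (dens_factor t)^-1) = (1 + t) * (w / dens_factor t).
  by rewrite dw in d0 *; field; rewrite !gt_eqF.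
have w2 : t * w ^+ 2 <= 49 / 50 / 2000.
  (* t w^2 has its local maximum at t = 6/25 *)
  have -> : t * w ^+ 2 =
      24 / 25 / 2500 - (24 / 25 - t) * (t - 6 / 25) ^+ 2 / 144.
    by rewrite /w; field.
  have : 0 <= (24 / 25 - t) * (t - 6 / 25) ^+ 2.
    by rewrite mulr_ge0 ?sqr_ge0 //; lra.
  lra.
have h2 : w - 1 / 2000 <= w / dens_factor t.
  rewrite ler_pdivlMr // dw; rewrite dw in dlb.
  have -> : (w - 1 / 2000) * (1 + t * w) = w + t * w ^+ 2 - (1 + t * w) / 2000.
    by field.
  lra.
have h3 : (1 + t) * (w - 1 / 2000) <= (1 + t) * (w / dens_factor t).
  by rewrite ler_wpM2l //; lra.
rewrite /w in h3 *; nra.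
Qed.

Lemma gain_pow_ge (k l : nat) (t := l%:R / k%:R : R) : (0 < k)%N -> (0 < l)%N ->
  t <= 9 / 10 ->
  expR (5 * (l%:R / 20 - l%:R ^+ 2 / (24 * k%:R))) <=
    dens_factor t ^+ (k + l) * (tail_prob t / t) ^+ l.
Proof.
move=> k0 l0 t1.
have K0 : 0 < k%:R :> R by rewrite ltr0n.
have L0 : 0 < l%:R :> R by rewrite ltr0n.
have t0 : 0 < t by rewrite divr_gt0.
have [dlb _] := dens_factor_bounds t (ltW t0) t1.
have d0 : 0 < dens_factor t by lra.
have q0 := tail_prob_gt0 t t0 t1.
have qt0 : 0 < tail_prob t / t by rewrite divr_gt0.
have hd : expR (1 - (dens_factor t)^-1) ^+ (k + l) <= dens_factor t ^+ (k + l).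
  by apply: lerXn2r; rewrite ?nnegrE ?expR_ge0 ?(ltW d0) ?expR_le.
have hq : expR (1 - t / tail_prob t) ^+ l <= (tail_prob t / t) ^+ l.
  have := expR_le _ qt0; rewrite invf_div => h.
  by apply: lerXn2r; rewrite ?nnegrE ?expR_ge0 ?(ltW qt0).
apply: le_trans (ler_pM _ _ hd hq); rewrite ?exprn_ge0 ?expR_ge0 //.
rewrite -!expRM_natl -expRD ler_expR.
have -> : 5 * (l%:R / 20 - l%:R ^+ 2 / (24 * k%:R)) =
   l%:R * (5 * (1 / 20 - t / 24)) :> R by rewrite /t; field; rewrite gt_eqF.
have -> : (k + l)%:R = l%:R * ((1 + t) / t) :> R.
  by rewrite natrD /t; field; rewrite !gt_eqF.
rewrite -mulrA -mulrDr ler_pM2l //; exact: gain_slope_ge.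
Qed.


(** * From the blue neighbourhoods to the Ramsey bound *)

(** Taking both sets of the pair equal to [S]: a vertex with few blue
    neighbours in [S] has many red ones, up to itself. *)
Lemma excess_ge (n : nat) (c : colouring n) (p rho : R) (S : {set 'I_n}) :
  (forall v, v \in S -> #|S :&: nbr c false v|%:R <= rho * #|S|%:R) ->
  #|S|%:R ^+ 2 * (1 - rho - p) - #|S|%:R <= excess c p S S.
Proof.
move=> hS.
have -> : #|S|%:R ^+ 2 * (1 - rho - p) - #|S|%:R =
    \sum_(y in S) (#|S|%:R - rho * #|S|%:R - 1 - p * #|S|%:R).
  by rewrite sumr_const -[RHS]mulr_natl; ring.
apply: ler_sum => y yS; rewrite lerD2r.
have e := card_nbr_split n c y S yS.
rewrite [X in X%:R - _ - _]e -natr1 natrD; have := hS y yS; lra.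
Qed.

(** The function U of the induction.  The saving l/20 - l^2/(24k) is concave in
    [l] and equals l/80 at l = 0 and at l = 9k/10, so it is at least l/80 in
    between. *)
Definition ramsey_bound (k l : nat) : R :=
  k%:R ^+ 5 * (expR (- (l%:R / 20 - l%:R ^+ 2 / (24 * k%:R))) *
  ('C(k + l, l))%:R).

Lemma ramsey_bound_gt0 k l : (0 < k)%N -> 0 < ramsey_bound k l.
Proof.
move=> k0; have K0 : 0 < k%:R :> R by rewrite ltr0n.
apply: mulr_gt0; first by rewrite exprn_gt0.
by rewrite mulr_gt0 ?expR_gt0 // ltr0n bin_gt0 leq_addl.
Qed.

(** The ratio of consecutive values of [ramsey_bound] in [l]: the proportion of
    blue neighbours that the induction on [l] allows. *)
Definition blue_share (k l : nat) (t := l%:R / k%:R : R) : R :=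
  t / (1 + t) * expR (1 / 20 - t / 12 + (24 * k%:R)^-1).

Lemma ramsey_boundS k l : (0 < k)%N ->
  ramsey_bound k l = blue_share k l.+1 * ramsey_bound k l.+1.
Proof.
move=> k0; have K0 : 0 < k%:R :> R by rewrite ltr0n.
have L0 : 0 < l.+1%:R :> R by rewrite ltr0n.
rewrite /ramsey_bound /blue_share.
set t := l.+1%:R / k%:R.
have -> : expR (- (l%:R / 20 - l%:R ^+ 2 / (24 * k%:R))) =
    expR (1 / 20 - t / 12 + (24 * k%:R)^-1) *
    expR (- (l.+1%:R / 20 - l.+1%:R ^+ 2 / (24 * k%:R))) :> R.
  rewrite -expRD; congr expR; rewrite /t -natr1; field.
  by rewrite gt_eqF.
have -> : ('C(k + l, l))%:R = t / (1 + t) * ('C(k + l.+1, l.+1))%:R :> R.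
  have := mul_bin_diag (k + l.+1) l; rewrite addnS /=.
  move=> /(congr1 (fun m => m%:R : R)); rewrite !natrM -!natr1 natrD => e.
  have -> : t / (1 + t) = (l%:R + 1) / (k%:R + l%:R + 1).
    rewrite /t -natr1; field.
    rewrite !gt_eqF //; have := ler0n R l; lra.
  rewrite mulrAC -e; field.
  rewrite !gt_eqF //; have := ler0n R l; lra.
ring.
Qed.

(** The gap is in fact of order t, which is at least 1/k; the weaker 2/k^3
    suffices, polynomial factors being harmless. *)
Lemma blue_share_gap k l (t := l%:R / k%:R : R) : (100 <= k)%N -> (0 < l)%N ->
  t <= 9 / 10 -> 2 / k%:R ^+ 3 <= 1 - blue_share k l - dens_factor t / (1 + t).
Proof.
move=> k100 l0 t1.
have K100 : 100 <= k%:R :> R by rewrite (ler_nat R 100).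
have L1 : 1 <= l%:R :> R by rewrite ler1n.
have t0 : 0 < t by rewrite divr_gt0 //; lra.
have tk : k%:R^-1 <= t by rewrite /t -[leLHS]mul1r ler_wpM2r // invr_ge0; lra.
set x := 1 / 20 - t / 12.
have h : expR (x + (24 * k%:R)^-1) <= x + 201 / 200.
  apply: expR_le_affine; rewrite /x ?invr_ge0; try lra.
  by rewrite div1r lef_pV2 ?posrE; lra.
have h2 : blue_share k l <= t / (1 + t) * (x + 201 / 200).
  by rewrite /blue_share -/t -/x ler_wpM2l // divr_ge0; lra.
have e : 1 - t / (1 + t) * (x + 201 / 200) - dens_factor t / (1 + t) =
   t / (1 + t) / 200 by rewrite /x /dens_factor; field; lra.
apply: (@le_trans _ _ (t / (1 + t) / 200)); last by rewrite -e; lra.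
apply: le_trans (_ : k%:R^-1 * (1 / 2 / 200) <= _); last first.
  rewrite -[leRHS]mulrA; apply: ler_pM; [by rewrite invr_ge0; lra|lra|exact: tk|].
  have u : 1 / 2 <= (1 + t)^-1 by rewrite div1r lef_pV2 ?posrE; lra.
  lra.
rewrite ler_pdivrMr; last by rewrite exprn_gt0 //; lra.
have -> : k%:R^-1 * (1 / 2 / 200) * k%:R ^+ 3 = k%:R ^+ 2 / 400 :> R.
  by field; rewrite gt_eqF //; lra.
nra.
Qed.

Lemma entropy_le_bin (k l : nat) (t := l%:R / k%:R : R) : (0 < k)%N -> (0 < l)%N ->
  (1 + t) ^+ (k + l) / t ^+ l <= (k + l).+1%:R * ('C(k + l, l))%:R.
Proof.
move=> k0 l0; have K0 : 0 < k%:R :> R by rewrite ltr0n.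
have L0 : 0 < l%:R :> R by rewrite ltr0n.
have := expn_le_bin k l k0 l0; rewrite -(ler_nat R) !natrM !natrX natrD => h.
have -> : (1 + t) ^+ (k + l) / t ^+ l =
    (k%:R + l%:R) ^+ (k + l) / (k%:R ^+ k * l%:R ^+ l).
  have -> : 1 + t = (k%:R + l%:R) / k%:R by rewrite /t; field; rewrite gt_eqF.
  rewrite /t !expr_div_n !exprD; field.
  by rewrite !expf_neq0 // gt_eqF.
by rewrite ler_pdivrMr ?mulr_gt0 ?exprn_gt0 // -mulrA.
Qed.

(** The bookkeeping of polynomial factors: [K] is k, [C] the binomial
    coefficient, [B] its approximation without factorials, and e^5 <= W is the
    exponential gain.  The power K^5 in the conclusion, raised to the fifth,
    beats the K^21 collected on the way. *)
Lemma lt_of_pow5_le (K e C B W N m m1 : R) :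
  10 <= K -> 0 < e -> 0 < C -> 0 < B -> 0 <= N -> 0 <= m -> m <= 2 * K ->
  m1 <= 3 * K -> B <= m1 * C -> e ^+ 5 <= W ->
  N ^+ 5 * W <= (K ^+ 3 * m) ^+ 4 * B ^+ 5 -> N < K ^+ 5 * (e^-1 * C).
Proof.
move=> K10 e0 C0 B0 N0 m0 mK m1K hB eW h; rewrite ltNge; apply/negP => hU.
have K0 : 0 < K by lra.
have hl : (K ^+ 5 * C) ^+ 5 <= N ^+ 5 * W.
  apply: (@le_trans _ _ (N ^+ 5 * e ^+ 5)); last first.
    by rewrite ler_wpM2l ?exprn_ge0.
  rewrite -exprMn; apply: lerXn2r.
  - by rewrite nnegrE mulr_ge0 ?exprn_ge0 ?ltW.
  - by rewrite nnegrE mulr_ge0 // ltW.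
  - by rewrite -ler_pdivrMr // -mulrA [C * _]mulrC.
have hr : (K ^+ 3 * m) ^+ 4 * B ^+ 5 <= (2 * K ^+ 4) ^+ 4 * (3 * K * C) ^+ 5.
  apply: ler_pM.
  - by rewrite exprn_ge0 // mulr_ge0 // exprn_ge0 // ltW.
  - by rewrite exprn_ge0 // ltW.
  - apply: lerXn2r; rewrite ?nnegrE.
    + by rewrite mulr_ge0 // exprn_ge0 // ltW.
    + by rewrite mulr_ge0 // exprn_ge0 // ltW.
    + have -> : 2 * K ^+ 4 = K ^+ 3 * (2 * K) by ring.
      by rewrite ler_wpM2l // exprn_ge0 // ltW.
  - apply: lerXn2r; rewrite ?nnegrE.
    + exact: ltW.
    + by rewrite !mulr_ge0 // ltW.
    + by apply: (le_trans hB); rewrite ler_wpM2r // ltW.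
have := le_trans hl (le_trans h hr).
have -> : (2 * K ^+ 4) ^+ 4 * (3 * K * C) ^+ 5 =
    K ^+ 21 * C ^+ 5 * (16 * 243) by ring.
have -> : (K ^+ 5 * C) ^+ 5 = K ^+ 21 * C ^+ 5 * K ^+ 4 by ring.
rewrite ler_pM2l; last by rewrite mulr_gt0 ?exprn_gt0.
rewrite leNgt; apply/negP; rewrite negbK.
have K2 : 100 <= K ^+ 2 by rewrite expr2; nra.
have -> : K ^+ 4 = K ^+ 2 * K ^+ 2 by ring.
nra.
Qed.

(** [excess_le] for the pair (S, S), with shares in the ratio 1 : t, against the
    lower bound [excess_ge].  As |S| is a fourth power z^4, the two bounds read
    z^8 <= poly(k) M a^k b^l z^3, and the fourth power of what is left bounds
    |S|^5 by the fifth power of a binomial coefficient over the gain. *)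
Lemma card_lt_ramsey_bound (n : nat) (c : colouring n) (S : {set 'I_n}) (k l : nat)
    (t := l%:R / k%:R : R) (rho : R) :
  (10 <= k)%N -> (0 < l)%N -> t <= 9 / 10 ->
  ~~ clique_in c true k S -> ~~ clique_in c false l S ->
  (forall v, v \in S -> #|S :&: nbr c false v|%:R <= rho * #|S|%:R) ->
  2 / k%:R ^+ 3 <= 1 - rho - dens_factor t / (1 + t) ->
  k%:R ^+ 3 <= #|S|%:R :> R ->
  #|S|%:R < ramsey_bound k l.
Proof.
move=> k10 l0 t1 nR nB hrho hgap hS.
have K1 : 10 <= k%:R :> R by rewrite (ler_nat R 10).
have k0 : (0 < k)%N by apply: leq_trans k10.
have L1 : 1 <= l%:R :> R by rewrite ler1n.
have t0 : 0 < t by rewrite divr_gt0 //; lra.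
have lk : l%:R <= k%:R :> R.
  have := t1; rewrite /t ler_pdivrMr; lra.
have [dlb dub] := dens_factor_bounds t (ltW t0) t1.
have d0 : 0 < dens_factor t by lra.
have q0 := tail_prob_gt0 t t0 t1.
set p := dens_factor t / (1 + t) in hgap.
have p0 : 0 < p by rewrite divr_gt0; lra.
have p1 : p <= 1 by rewrite ler_pdivrMr; lra.
pose P := root4 p.
have P4 : P ^+ 4 = p by rewrite root4K // ltW.
have P0 : 0 < P.
  rewrite lt_neqAle root4_ge0 andbT; apply: contraTneq p0 => PE.
  by rewrite -P4 -PE expr0n ltxx.
have P1 : P <= 1.
  by rewrite -(@ler_pXn2r _ 4) ?nnegrE ?(ltW P0) // P4 expr1n.
pose M := root4 ((tail_prob t)^-1 ^+ l).
have M0 : 0 <= M by apply: root4_ge0.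
have M4 : M ^+ 4 = (tail_prob t)^-1 ^+ l.
  by rewrite root4K // exprn_ge0 // invr_ge0 ltW.
pose a := (1 + t) / P.
have a0 : 0 < a by rewrite divr_gt0 //; lra.
have a4 : a ^+ 4 = (1 + t) ^+ 5 / dens_factor t.
  rewrite expr_div_n P4 /p; field; rewrite !gt_eqF //; lra.
pose b := a / t.
have b1 : 1 <= b.
  rewrite ler_pdivlMr // mul1r ler_pdivlMr //.
  by have := ler_piMr (ltW t0) P1; lra.
have ab : a^-1 + b^-1 <= P.
  rewrite le_eqVlt; apply/orP; left; apply/eqP; rewrite /b /a; field.
  rewrite !gt_eqF //; lra.
have aq : a ^+ 4 = (1 - tail_prob t)^-1.
  rewrite a4 /tail_prob; field; rewrite !gt_eqF ?exprn_gt0 //; lra.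
have qd : 1 - tail_prob t = dens_factor t / (1 + t) ^+ 5.
  by rewrite /tail_prob; ring.
have q1 : 0 < 1 - tail_prob t by rewrite qd divr_gt0 ?exprn_gt0 //; lra.
have hM j : ('C(j + l, j))%:R <= (M * a ^+ j) ^+ 4.
  have h := bin_mul_exp_le1 R (tail_prob t) j l (ltW q0) _.
  rewrite exprMn M4 exprAC aq !exprVn -invfM -[leRHS]div1r.
  rewrite ler_pdivlMr ?mulr_gt0 ?exprn_gt0 // [X in _ * X]mulrC h //; lra.
have := excess_le R n c P M a b l P0 P1 M0 a0 b1 ab hM k l S S.
rewrite finset.setUid P4 => /(_ nR nB nB) up.
have low := excess_ge n c p rho S hrho.
set N := #|S|%:R in hS up low *.
have Kp : 0 < k%:R ^+ 3 :> R by rewrite exprn_gt0 //; lra.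
have N0 : 0 < N by apply: lt_le_trans hS.
pose z := root4 N.
have z4 : z ^+ 4 = N by rewrite root4K // ltW.
have z0 : 0 < z.
  rewrite lt_neqAle root4_ge0 andbT; apply: contraTneq N0 => zE.
  by rewrite -z4 -zE expr0n ltxx.
(* half of the gap pays for the vertices that are not their own neighbours *)
have low2 : N ^+ 2 / k%:R ^+ 3 <= N ^+ 2 * (1 - rho - p) - N.
  apply: (@le_trans _ _ (N ^+ 2 * (2 / k%:R ^+ 3) - N)); last first.
    by rewrite lerD2r ler_wpM2l // sqr_ge0.
  have -> : N ^+ 2 * (2 / k%:R ^+ 3) - N =
      N ^+ 2 / k%:R ^+ 3 + N * (N / k%:R ^+ 3 - 1).
    by field; rewrite gt_eqF //; lra.
  by rewrite lerDl mulr_ge0 ?(ltW N0) // subr_ge0 ler_pdivlMr // mul1r.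
have main1 : z ^+ 5 <= k%:R ^+ 3 * (k + l)%:R * (M * a ^+ k * b ^+ l).
  rewrite -(ler_pM2r (_ : 0 < z ^+ 3)) ?exprn_gt0 //.
  have -> : z ^+ 5 * z ^+ 3 = N ^+ 2 by rewrite -z4; ring.
  have := le_trans low2 (le_trans low up).
  rewrite ler_pdivrMr // => h; apply: (le_trans h).
  by rewrite -/z le_eqVlt; apply/orP; left; apply/eqP; ring.
pose B : R := (1 + t) ^+ (k + l) / t ^+ l.
pose W : R := dens_factor t ^+ (k + l) * (tail_prob t / t) ^+ l.
have W0 : 0 < W by rewrite mulr_gt0 ?exprn_gt0 // divr_gt0.
have main2 : N ^+ 5 * W <= (k%:R ^+ 3 * (k + l)%:R) ^+ 4 * B ^+ 5.
  have -> : N ^+ 5 = (z ^+ 5) ^+ 4 by rewrite -z4 exprAC.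
  apply: (@le_trans _ _
    ((k%:R ^+ 3 * (k + l)%:R * (M * a ^+ k * b ^+ l)) ^+ 4 * W)).
    rewrite ler_pM2r //; apply: lerXn2r => //; rewrite nnegrE.
      by rewrite exprn_ge0 // ltW.
    by apply: le_trans main1; rewrite exprn_ge0 // ltW.
  rewrite [X in X * W]exprMn -[leLHS]mulrA.
  apply: ler_wpM2l; first by rewrite exprn_ge0 // mulr_ge0 // ltW.
  rewrite le_eqVlt; apply/orP; left; apply/eqP.
  have -> : (M * a ^+ k * b ^+ l) ^+ 4 =
      (tail_prob t)^-1 ^+ l * (a ^+ 4) ^+ (k + l) * (t^-1 ^+ l) ^+ 4.
    by rewrite -M4 [_ ^+ 4 ^+ _]exprAC exprD /b [(a / t) ^+ l]exprMn; ring.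
  rewrite a4 /W /B !exprVn [(_ / dens_factor t) ^+ _]expr_div_n.
  rewrite [(tail_prob t / t) ^+ l]expr_div_n.
  rewrite [(1 + t) ^+ 5 ^+ _]exprAC; field.
  by rewrite !expf_neq0 // gt_eqF //; lra.
have sW : expR (5 * (l%:R / 20 - l%:R ^+ 2 / (24 * k%:R))) <= W.
  exact: gain_pow_ge.
have hB : B <= (k + l).+1%:R * ('C(k + l, l))%:R by apply: entropy_le_bin.
rewrite /ramsey_bound expRN.
apply: (@lt_of_pow5_le _ _ _ B W _ (k + l)%:R (k + l).+1%:R) => //.
- by rewrite ltr0n bin_gt0 leq_addl.
- by rewrite divr_gt0 ?exprn_gt0 //; lra.
- by rewrite natrD; lra.
- by rewrite -natr1 natrD; lra.
- by rewrite -expRM_natl.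
Qed.


(** The lower bound k^5 is carried along so that [S] is large enough for
    [card_lt_ramsey_bound]; the induction on [l] supplies its hypothesis on blue
    neighbourhoods. *)
Lemma clique_of_ramsey_bound (k l : nat) :
  (100 <= k)%N -> l%:R / k%:R <= 9 / 10 :> R ->
  k%:R ^+ 5 <= ramsey_bound k l /\
  forall (n : nat) (c : colouring n) (S : {set 'I_n}),
    ramsey_bound k l <= #|S|%:R ->
    clique_in c true k S || clique_in c false l S.
Proof.
move=> k100; have k0 : (0 < k)%N by apply: leq_trans k100.
have K1 : 1 <= k%:R :> R by rewrite ler1n.
elim: l => [|l IH] lk.
  split=> [|n c S _]; last by rewrite clique_in0 orbT.
  by rewrite /ramsey_bound addn0 bin0 expr0n /= !mul0r subr0 oppr0 expR0 !mulr1.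
have {}lk0 : l%:R / k%:R <= 9 / 10 :> R.
  by apply: le_trans lk; rewrite ler_pM2r ?invr_gt0 ?ltr0n // ler_nat.
have [Ul IHl] := IH lk0.
set t : R := l.+1%:R / k%:R in lk.
have t0 : 0 < t by rewrite divr_gt0 ?ltr0n.
have gap : 2 / k%:R ^+ 3 <= 1 - blue_share k l.+1 - dens_factor t / (1 + t).
  exact: blue_share_gap.
have [dlb _] := dens_factor_bounds t (ltW t0) lk.
have U0 := ramsey_bound_gt0 k l.+1 k0.
have r1 : blue_share k l.+1 <= 1.
  have : 0 <= dens_factor t / (1 + t) by rewrite divr_ge0; lra.
  have : 0 <= 2 / k%:R ^+ 3 :> R by rewrite divr_ge0 ?exprn_ge0.
  lra.
have UU : k%:R ^+ 5 <= ramsey_bound k l.+1.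
  apply: (le_trans Ul); rewrite ramsey_boundS //.
  by rewrite ler_piMl // ltW.
split=> // n c S hS; apply: contraT; rewrite negb_or => /andP [nR nB].
have : #|S|%:R < ramsey_bound k l.+1.
  apply: (@card_lt_ramsey_bound n c S k l.+1 (blue_share k l.+1)) => //.
  - by apply: leq_trans k100.
  - move=> v vS; rewrite leNgt; apply/negP => hv.
    have : ramsey_bound k l <= #|S :&: nbr c false v|%:R.
      apply: le_trans (ltW hv); rewrite ramsey_boundS // ler_wpM2l //.
      rewrite mulr_ge0 ?expR_ge0 // divr_ge0 //; lra.
    move=> hv'; have /orP[h|h] := IHl n c _ hv'.
      by case/negP: nR; apply: clique_in_subset h; apply: subsetIl.
    by case/negP: nB; apply: clique_in_nbr h.
  - by apply: le_trans hS; apply: le_trans UU; rewrite ler_weXn2l.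
by rewrite ltNge hS.
Qed.

Lemma ramsey_le (k l N : nat) :
  (forall c : colouring N, clique_in c true k finset.setT ||
     clique_in c false l finset.setT) -> (ramsey k l <= N)%N.
Proof.
move=> h; rewrite /ramsey; case: ex_minnP => m _; apply.
apply/forallP => c; case/orP: (h c) => /existsP [A /and3P [_ cA mA]];
  apply/orP; [left|right]; apply/existsP; exists A; exact/andP.
Qed.

Local Open Scope classical_set_scope.
Local Open Scope ring_scope.

Lemma error_term_cvg0 :
  (1 + 10 * Num.sqrt k%:R) / k%:R @[k --> \oo] --> (0 : R).
Proof.
apply/cvgr0Pnorm_lt => e e0; near=> k.
have ke : (11 / e) ^+ 2 < k%:R.
  by near: k; apply: nbhs_infty_gtr.
have k1 : 1 <= k%:R :> R.
  by rewrite ler1n; near: k; exists 1%N.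
set s := Num.sqrt _.
have s0 : 0 <= s by apply: sqrtr_ge0.
have ss : s ^+ 2 = k%:R by rewrite sqr_sqrtr //; lra.
have s1 : 1 <= s by rewrite -ss in k1; rewrite -(@ler_pXn2r _ 2) ?nnegrE // expr1n.
have es : 11 / e < s.
  rewrite -(@ltr_pXn2r _ 2) ?nnegrE // ?ss // divr_ge0 //; lra.
rewrite ger0_norm; last by rewrite divr_ge0 // ; lra.
rewrite ltr_pdivrMr; last by lra.
rewrite ltr_pdivrMr // in es.
rewrite -ss; nra.
Unshelve. all: by end_near.
Qed.

End Bound.

Local Open Scope classical_set_scope.
Local Open Scope ring_scope.

Theorem theorem13p1 (R : realType) :
  exists o : nat -> R,
    (o k / k%:R @[k --> \oo] --> (0 : R)) /\
    exists N : nat, forall k l : nat,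
      (N <= k)%N -> (N <= l)%N -> (l%:R : R) <= 9 * k%:R / 10 ->
      (ramsey k l)%:R <= expR (- (l%:R / 80) + o k) * ('C(k + l, l))%:R.
Proof.
(* 2 k^5 <= e^(1 + 10 sqrt k), as sqrt k <= e^(sqrt k) *)
exists (fun k => 1 + 10 * Num.sqrt k%:R); split; first exact: error_term_cvg0.
exists 100%N => k l k100 _ lk.
have k0 : (0 < k)%N by apply: leq_trans k100.
have K0 : 0 < k%:R :> R by rewrite ltr0n.
have lk' : l%:R / k%:R <= 9 / 10 :> R by rewrite ler_pdivrMr //; lra.
have [U1 hU] := clique_of_ramsey_bound R k l k100 lk'.
(* an integer just above the bound; rounding up costs a factor 2 *)
pose N := (Num.truncn (ramsey_bound R k l)).+1.
have U0 : 0 <= ramsey_bound R k l by apply: le_trans U1; rewrite exprn_ge0.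
have hr : (ramsey k l <= N)%N.
  apply: ramsey_le => c; apply: hU.
  by rewrite cardsT card_ord ltW // truncnS_gt.
have NU : N%:R <= 2 * ramsey_bound R k l.
  have h1 : (Num.truncn (ramsey_bound R k l))%:R <= ramsey_bound R k l.
    by rewrite truncn_le.
  have h2 : 1 <= ramsey_bound R k l.
    by apply: le_trans U1; rewrite exprn_ege1 // ler1n.
  rewrite /N -natr1; lra.
apply: (@le_trans _ _ (2 * ramsey_bound R k l)).
  by apply: le_trans NU; rewrite ler_nat.
rewrite /ramsey_bound [k%:R ^+ 5 * _]mulrA mulrA ler_wpM2r // expRD mulrA mulrC.
set s := Num.sqrt _.
have s0 : 0 <= s by apply: sqrtr_ge0.
have ss : s ^+ 2 = k%:R by rewrite sqr_sqrtr // ltW.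
apply: ler_pM; rewrite ?expR_ge0 ?mulr_ge0 ?exprn_ge0 //.
  rewrite ler_expR lerN2.
  have -> : l%:R / 20 - l%:R ^+ 2 / (24 * k%:R) =
     l%:R / 80 + l%:R / 24 * (9 / 10 - l%:R / k%:R) :> R by field; lra.
  by rewrite lerDl mulr_ge0 ?divr_ge0 // subr_ge0.
rewrite expRD; apply: ler_pM; rewrite ?exprn_ge0 //.
  by have := expR_ge1Dx (1 : R); lra.
have -> : k%:R ^+ 5 = s ^+ 10 by rewrite -ss -exprM.
rewrite expRM_natl; apply: lerXn2r; rewrite ?nnegrE ?expR_ge0 //.
by have := expR_ge1Dx s; lra.
Qed.
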